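(* Fix distinct positive integers $d_1,\dots,d_r$. For a prime $p$ and $d\in\mathbb{Z}_{\ge 1}$, let $\mathcal{M}(p,d)$ denote the set of monic irreducible polynomials of degree $d$ in $\mathbb{F}_p[t]$. For each $n\in\mathbb{Z}_{\ge1}$, the limit $$L_n:=\lim_{p\to\infty}\ \mathrm{Prob}_{A\in \mathrm{Mat}_n(\mathbb{Z}_p)}\Big(\operatorname{coker}(P(A))=0 \text{ for all } \bar P\in \textstyle\bigsqcup_{j=1}^r \mathcal{M}(p,d_j)\Big)$$ exists (the limit over primes $p$), where for each $\bar P$ one uses any lift $P\in\mathbb{Z}_p[t]$ of $\bar P$ under reduction modulo $p$, and the probability is with respect to the Haar probability measure on $\mathrm{Mat}_n(\mathbb{Z}_p)=\mathbb{Z}_p^{n^2}$. Moreover, $$\lim_{n\to\infty} L_n = e^{-1/d_1}\cdots e^{-1/d_r}.$$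
   Context: $\mathbb{Z}_p$ is the ring of $p$-adic integers. For $A\in\mathrm{Mat}_n(\mathbb{Z}_p)$ and $P\in\mathbb{Z}_p[t]$, $P(A)\in\mathrm{Mat}_n(\mathbb{Z}_p)$ and $\operatorname{coker}(P(A))=\mathbb{Z}_p^n/P(A)\mathbb{Z}_p^n$. *)

(* Defs.v *)
From HB Require Import structures.
From mathcomp Require Import all_boot all_order all_algebra.
From mathcomp Require Import all_classical all_reals all_analysis.
Import Order.TTheory GRing.Theory Num.Theory.

Set Implicit Arguments.
Unset Strict Implicit.
Unset Printing Implicit Defensive.

Local Open Scope classical_set_scope.
Local Open Scope ring_scope.

(* The p-adic integers as the inverse limit of Z/p <- Z/p^2 <- Z/p^3 <- ...
   The k-th component is the residue modulo p ^ k.+1; the exponent starts at 1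
   because 'Z_1 is Z/2. For p <= 1 the type is a junk nontrivial ring, which
   lets p range over nat without carrying a primality proof. *)
Section PadicIntegers.
Variable p : nat.

Definition coherent (x : forall k, 'Z_(p ^ k.+1)) : Prop :=
  forall k, inZp (x k.+1) = x k.

Record padic_int := PadicInt {
  residue :> forall k, 'Z_(p ^ k.+1);
  _ : `[< coherent residue >] }.

HB.instance Definition _ := [isSub for residue].
HB.instance Definition _ := [Choice of padic_int by <:].

Lemma padic_intP (x : padic_int) : coherent x.
Proof. exact/asboolP/(valP x). Qed.

Lemma padic_int_inj (x y : padic_int) : (forall k, x k = y k) -> x = y.
Proof. by move=> xy; apply/val_inj/functional_extensionality_dep. Qed.

Lemma level_dvd k : ((Zp_trunc (p ^ k.+1)).+2 %| (Zp_trunc (p ^ k.+2)).+2)%N.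
Proof.
case: p => [|[|q]]; [by rewrite !exp0n | by rewrite !exp1n |].
have gt1 j : (1 < q.+2 ^ j.+1)%N by apply: leq_trans (ltn_expl j.+1 _).
by rewrite !Zp_cast // dvdn_exp2l.
Qed.

Lemma coherent0 : coherent (fun=> 0).
Proof. by move=> k; apply/val_inj; rewrite /= mod0n. Qed.

Lemma coherent1 : coherent (fun=> 1).
Proof. by move=> k; apply/val_inj. Qed.

Lemma coherentN (x : padic_int) : coherent (fun k => - x k).
Proof.
move=> k; apply/val_inj; rewrite /= (modn_dvdm _ (level_dvd k)).
have /(congr1 val)/= <- := padic_intP x k.
have : (x k.+1 <= (Zp_trunc (p ^ k.+2)).+2)%N by rewrite ltnW.
set N := (Zp_trunc _).+2; set M := (Zp_trunc _).+2 => leN.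
have dMN : (M %| N)%N by exact: level_dvd.
have leM : (x k.+1 %% M <= M)%N by rewrite ltnW // ltn_mod.
apply/eqP; rewrite -(eqn_modDr (x k.+1)) subnK // -modnDmr subnK //.
by rewrite modnn; exact: dMN.
Qed.

Lemma coherentD (x y : padic_int) : coherent (fun k => x k + y k).
Proof.
move=> k; rewrite -(padic_intP x k) -(padic_intP y k); apply/val_inj => /=.
by rewrite (modn_dvdm _ (level_dvd k)) modnDm.
Qed.

Lemma coherentM (x y : padic_int) : coherent (fun k => x k * y k).
Proof.
move=> k; rewrite -(padic_intP x k) -(padic_intP y k); apply/val_inj => /=.
by rewrite (modn_dvdm _ (level_dvd k)) modnMm.
Qed.

Definition padic0 := PadicInt (asboolT coherent0).
Definition padic1 := PadicInt (asboolT coherent1).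
Definition padicN x := PadicInt (asboolT (coherentN x)).
Definition padicD x y := PadicInt (asboolT (coherentD x y)).
Definition padicM x y := PadicInt (asboolT (coherentM x y)).

Fact padicDA : associative padicD.
Proof. by move=> x y z; apply: padic_int_inj => k; exact: addrA. Qed.
Fact padicDC : commutative padicD.
Proof. by move=> x y; apply: padic_int_inj => k; exact: addrC. Qed.
Fact padic0D : left_id padic0 padicD.
Proof. by move=> x; apply: padic_int_inj => k; exact: add0r. Qed.
Fact padicND : left_inverse padic0 padicN padicD.
Proof. by move=> x; apply: padic_int_inj => k; exact: addNr. Qed.

HB.instance Definition _ :=
  GRing.isZmodule.Build padic_int padicDA padicDC padic0D padicND.

Fact padicMA : associative padicM.
Proof. by move=> x y z; apply: padic_int_inj => k; exact: mulrA. Qed.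
Fact padicMC : commutative padicM.
Proof. by move=> x y; apply: padic_int_inj => k; exact: mulrC. Qed.
Fact padic1M : left_id padic1 padicM.
Proof. by move=> x; apply: padic_int_inj => k; exact: mul1r. Qed.
Fact padicMD : left_distributive padicM +%R.
Proof. by move=> x y z; apply: padic_int_inj => k; exact: mulrDl. Qed.
Fact padic1_neq0 : padic1 != 0.
Proof. by apply/eqP => /(congr1 (fun x : padic_int => val (x 0%N))). Qed.

HB.instance Definition _ := GRing.Zmodule_isComNzRing.Build padic_int
  padicMA padicMC padic1M padicMD padic1_neq0.

HB.instance Definition _ := isPointed.Build padic_int 0.

(* The p-adic topology, as a subspace of the product of the discrete Z/p^k. *)
HB.instance Definition _ := Topological.copy padic_int
  (initial_topology (residue : padic_int ->
     prod_topology (fun k => discrete_topology 'Z_(p ^ k.+1)))).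

(* The residue map Z_p -> F_p (a ring morphism when p is prime). *)
Definition reduce (x : padic_int) : 'F_p := (x 0%N : nat)%:R.

End PadicIntegers.

(* Square p-adic matrices with the Borel sigma-algebra of the (entrywise)
   p-adic topology. *)
Definition padic_mx (p n : nat) :=
  g_sigma_algebraType (@open 'M[padic_int p]_n).

(* By uniqueness of the Haar measure, a translation-invariant Borel probability
   measure on the compact group Mat_n(Z_p) is its Haar probability measure. *)
Definition is_haar (R : realType) (p n : nat)
    (mu : probability (padic_mx p n) R) : Prop :=
  forall (B : 'M[padic_int p]_n) (X : set (padic_mx p n)),
    measurable X -> mu [set B + A | A in (X : set 'M[padic_int p]_n)] = mu X.

Section Cokernel.
Variables (S : pzRingType) (m n : nat) (M : 'M[S]_(m, n)).

Definition mximage : {pred 'cV[S]_m} :=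
  fun v => `[< exists w : 'cV[S]_n, v = M *m w >].

Fact mximage_zmod_closed : zmod_closed mximage.
Proof.
split=> [|_ _ /asboolP[u ->] /asboolP[v ->]]; apply/asboolP.
  by exists 0; rewrite mulmx0.
by exists (u - v); rewrite mulmxBr.
Qed.

HB.instance Definition _ :=
  GRing.isZmodClosed.Build 'cV[S]_m mximage mximage_zmod_closed.

Definition coker : zmodType := Quotient.quot mximage.

End Cokernel.

Definition monic_irreducible (p d : nat) : set {poly 'F_p} :=
  [set Q | [/\ Q \is monic, irreducible_poly Q & size Q = d.+1]].
Arguments monic_irreducible : clear implicits.

(* Main.v *)
(* The cokernel of P(A) vanishes iff P(A) is invertible modulo p, so the event
   only depends on A mod p, which Haar measure distributes uniformly on
   Mat_n(F_p).

   For a monic f of degree n let C_f be its companion matrix. The pairs (A, v)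
   with v a cyclic (row) vector of A are in bijection with GL_n x {monic f} by
   (g, f) |-> (g^-1 C_f g, first row of g), and Q(g^-1 C_f g) is invertible iff
   Q and f are coprime. As |GL_n(F_p)| / p^(n^2) tends to 1, the probability is
   asymptotically the proportion of monic f of degree n with no irreducible
   factor whose degree is some d_j.

   Sieving out one irreducible at a time, this proportion is the sum of the
   coefficients of degree at most n of prod_Q (1 - (X/p)^deg Q), the product
   being over the excluded Q. The number N_e of monic irreducibles of degree e
   satisfies N_e / p^e -> 1/e, so (1 - (X/p)^e)^N_e tends coefficientwise to
   exp(-X^e/e), and L_n is the n-th partial sum of the coefficients of
   exp(- sum_j X^(d_j)/d_j), an entire function; this tends to its value at 1.

   The estimate on N_e comes by strong induction from the same sieve: a monic
   polynomial of degree d is irreducible iff it has no irreducible factor of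
   lower degree. *)
From HB Require Import structures.
Require Import Defs.
From mathcomp Require Import all_boot all_order all_algebra.
From mathcomp Require Import all_classical all_reals all_analysis.
From mathcomp Require Import zify ring.
Import Order.TTheory GRing.Theory Num.Theory.
Import numFieldNormedType.Exports.

Set Implicit Arguments.
Unset Strict Implicit.
Unset Printing Implicit Defensive.

Local Open Scope ring_scope.

(** * Monic polynomials and cyclic matrices *)

(** Encoding a monic polynomial of degree [n] by its lower coefficients turns counting over a finite
    field into counting row vectors. *)
Definition monic_of (F : fieldType) n (w : 'rV[F]_n) : {poly F} :=
  'X^n + rVpoly w.

Lemma size_monic_of (F : fieldType) n (w : 'rV[F]_n) :
  size (monic_of w) = n.+1.
Proof. by rewrite size_polyDl size_polyXn // ltnS size_poly. Qed.

Lemma monic_of_monic (F : fieldType) n (w : 'rV[F]_n) : monic_of w \is monic.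
Proof.
by rewrite monicE lead_coefDl ?lead_coefXn // size_polyXn ltnS size_poly.
Qed.

Section Companion.
Variables (F : fieldType) (n : nat) (w : 'rV[F]_n.+1).
Local Notation f := (monic_of w).

(** Multiplication by [X] on [F[X]/(f)], in the basis [1, X, ..., X^n]. *)
Definition mulX_mod (v : 'rV[F]_n.+1) : 'rV[F]_n.+1 :=
  poly_rV (('X * rVpoly v) %% f).

Fact mulX_mod_linear : linear mulX_mod.
Proof.
move=> a u v; rewrite /mulX_mod !linearP /= mulrDr -scalerAr modpD modpZl.
by rewrite !linearP.
Qed.

HB.instance Definition _ :=
  GRing.isLinear.Build F 'rV[F]_n.+1 'rV[F]_n.+1 _ mulX_mod mulX_mod_linear.

Definition companion : 'M[F]_n.+1 := lin1_mx mulX_mod.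

Lemma rVpoly_companion v : rVpoly (v *m companion) = ('X * rVpoly v) %% f.
Proof.
rewrite mul_rV_lin1 /= /mulX_mod poly_rV_K // -ltnS -(size_monic_of w).
by rewrite ltn_modp -size_poly_gt0 size_monic_of.
Qed.

(** The companion matrix makes row vectors the module [F[X]/(f)]; the case [h = X] propagates by
    Horner induction on [h]. *)
Lemma rVpoly_horner_companion v h :
  rVpoly (v *m horner_mx companion h) = (h * rVpoly v) %% f.
Proof.
elim/poly_ind: h v => [|h c IH] v.
  by rewrite rmorph0 mulmx0 linear0 mul0r mod0p.
rewrite rmorphD rmorphM /= horner_mx_X horner_mx_C mulmxDr linearD /=.
rewrite mulmxA rVpoly_companion IH modp_mul mulrDl modpD; congr (_ %% f + _).
  by rewrite mulrA [h * 'X]mulrC.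
rewrite mul_mx_scalar linearZ /= mul_polyC modpZl modp_small //.
by rewrite size_monic_of ltnS size_poly.
Qed.

(** A Bezout coefficient inverts [Q] modulo [f], whereas a nontrivial gcd makes [Q] a zero divisor
    there. *)
Lemma horner_companion_unit Q : (horner_mx companion Q \in unitmx) = coprimep Q f.
Proof.
have sf : size f = n.+2 by exact: size_monic_of.
have f0 : f != 0 by rewrite -size_poly_gt0 sf.
apply/idP/idP => [uQ|/Bezout_eq1_coprimepP[[u v] /= uv]].
  have : ~~ (size (gcdp Q f) > 1)%N.
    apply/negP => sg.
    have fE : f = (f %/ gcdp Q f) * gcdp Q f by rewrite divpK ?dvdp_gcdr.
    set g := f %/ gcdp Q f in fE.
    have g0 : g != 0 by apply: contraNneq f0 => g0; rewrite fE g0 mul0r.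
    have sgf : (size g <= n.+1)%N.
      rewrite -ltnS -sf size_divp ?gcdp_eq0 ?(negPf f0) ?andbF //.
      by case: (size (gcdp Q f)) sg => [|[|k]] // _; rewrite sf /=; lia.
    (* The class of [f / gcd(Q, f)] is nonzero but killed by [Q]. *)
    have : poly_rV g *m horner_mx companion Q = 0.
      apply: (can_inj (@rVpolyK _ _)); rewrite rVpoly_horner_companion poly_rV_K //.
      rewrite linear0; apply/eqP.
      rewrite -/(_ %| _) -(divpK (dvdp_gcdl Q f)) -mulrA [_ * g]mulrC -fE.
      exact: dvdp_mull.
    move/(congr1 (fun x => rVpoly (x *m invmx (horner_mx companion Q)))).
    by rewrite mulmxK // mul0mx linear0 poly_rV_K // => /eqP; rewrite (negPf g0).
  rewrite -leqNgt /coprimep leq_eqVlt ltnS leqn0 size_poly_eq0 gcdp_eq0.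
  by rewrite (negPf f0) andbF orbF.
have : horner_mx companion u *m horner_mx companion Q = 1%:M.
  rewrite -[LHS]/(_ * _) -rmorphM /=.
  apply/row_matrixP => i; rewrite !rowE; apply: (can_inj (@rVpolyK _ _)).
  rewrite rVpoly_horner_companion mulmx1.
  have -> : u * Q = 1 - v * f by rewrite -uv addrK.
  rewrite mulrBl mul1r modpD modNp -mulrA mulrCA modp_mulr oppr0 addr0.
  by rewrite modp_small // sf ltnS size_poly.
by case/mulmx1_unit.
Qed.

Lemma row_companion (i : 'I_n) :
  delta_mx 0 (widen_ord (leqnSn n) i) *m companion
  = delta_mx 0 (lift ord0 i) :> 'rV_n.+1.
Proof.
apply: (can_inj (@rVpolyK _ _)); rewrite rVpoly_companion !rVpoly_delta /= -exprS.
by rewrite modp_small // size_polyXn size_monic_of !ltnS ltn_ord.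
Qed.

Lemma row_companion_max : (delta_mx 0 ord_max : 'rV_n.+1) *m companion = - w.
Proof.
apply: (can_inj (@rVpolyK _ _)); rewrite rVpoly_companion rVpoly_delta /= -exprS.
have -> : 'X^(n.+1) = 1 * f + rVpoly (- w) by rewrite mul1r linearN /= addrK.
by rewrite modpD modp_mull add0r modp_small // size_monic_of ltnS size_poly.
Qed.

End Companion.

Lemma companion_inj (F : fieldType) n : injective (@companion F n).
Proof.
by move=> u v uv; apply: oppr_inj; rewrite -!row_companion_max uv.
Qed.

(** * Counting matrices through cyclic pairs *)

Section MatrixCount.
Variables (F : finFieldType) (n : nat).

Definition cyclic_pair (gw : {'GL_n.+1[F]} * 'rV[F]_n.+1) :
    'M[F]_n.+1 * 'rV[F]_n.+1 :=
  (invmx (val gw.1) *m companion gw.2 *m val gw.1, row 0 (val gw.1)).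

(* The rows of g are v, vA, vA^2, ..., so (A, v) determines g; then the last
   row of g A g^-1 determines w. *)
Lemma cyclic_pair_inj : injective cyclic_pair.
Proof.
move=> [g w] [h u] [/= eA ev].
have Eg : val g *m (invmx (val g) *m companion w *m val g) = companion w *m val g.
  by rewrite !mulmxA mulmxV ?mul1mx //; exact: (valP g).
have Eh : val h *m (invmx (val h) *m companion u *m val h) = companion u *m val h.
  by rewrite !mulmxA mulmxV ?mul1mx //; exact: (valP h).
have egh : val g = val h.
  apply/row_matrixP; case; elim=> [|i IH] lti.
    by rewrite (_ : Ordinal lti = 0) //; apply: val_inj.
  pose j := Ordinal (lti : i < n)%N.
  have -> : Ordinal lti = lift ord0 j by apply: val_inj.
  (* Row [i + 1] is row [i] times the common matrix [A]. *)
  rewrite !rowE -{1}(row_companion w) -(row_companion u) -!mulmxA -Eg -Eh eA !mulmxA.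
  have E := IH (ltnW lti).
  rewrite (_ : Ordinal (ltnW lti) = widen_ord (leqnSn n) j) in E;
    last exact: val_inj.
  by rewrite !rowE in E; rewrite E.
have gh : g = h by apply: val_inj.
subst h; congr (_, _); apply: companion_inj.
have := Eg; rewrite eA Eh => /(congr1 (mulmx^~ (invmx (val g)))).
by rewrite !mulmxK //; exact: (valP g).
Qed.

Variable Is : seq {poly F}.

Definition good_mx (A : 'M[F]_n.+1) :=
  all (fun Q => horner_mx A Q \in unitmx) Is.
Definition good_poly (w : 'rV[F]_n.+1) := all (fun Q => coprimep Q (monic_of w)) Is.

Lemma good_cyclic_pair gw : good_mx (cyclic_pair gw).1 = good_poly gw.2.
Proof.
case: gw => g w; apply: eq_all => Q /=.
have ug : val g \in unitmx by exact: (valP g).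
rewrite horner_mx_uconjC // -horner_companion_unit !unitmx_mul unitmx_inv ug.
by rewrite andbT.
Qed.

(** [cyclic_pair] injects pairs (invertible [g], good [w]) into pairs (good matrix, row vector). *)
Lemma card_good_mx_ge :
  (#|'GL_n.+1[F]%g| * #|[set w | good_poly w]| <=
   #|[set A | good_mx A]| * #|F| ^ n.+1)%N.
Proof.
have -> : (#|F| ^ n.+1 = #|[set: 'rV[F]_n.+1]|)%N.
  by rewrite cardsT card_mx mul1n.
rewrite -!cardsX -(card_imset _ cyclic_pair_inj) subset_leq_card //.
apply/fintype.subsetP => _ /imsetP[[g w] /finset.setXP[_ gw] ->].
rewrite !inE in gw; rewrite finset.in_setX !inE andbT /=.
by rewrite (good_cyclic_pair (g, w)).
Qed.

(** The same injection on the complements; it bounds the good matrices from above, as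
    [card_good_mx_ge] does from below. *)
Lemma card_bad_mx_ge :
  (#|'GL_n.+1[F]%g| * (#|F| ^ n.+1 - #|[set w | good_poly w]|) <=
   (#|F| ^ (n.+1 * n.+1) - #|[set A | good_mx A]|) * #|F| ^ n.+1)%N.
Proof.
have -> : (#|F| ^ n.+1 - #|[set w | good_poly w]|
   = #|~: [set w | good_poly w]|)%N.
  have <- : (#|{: 'rV[F]_n.+1}| = #|F| ^ n.+1)%N by rewrite card_mx mul1n.
  by rewrite -(cardsC [set w | good_poly w]) addKn.
have -> : (#|F| ^ (n.+1 * n.+1) - #|[set A | good_mx A]|
   = #|~: [set w | good_mx w]|)%N.
  by rewrite -card_mx -(cardsC [set w | good_mx w]) addKn.
have -> : (#|F| ^ n.+1 = #|[set: 'rV[F]_n.+1]|)%N.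
  by rewrite cardsT card_mx mul1n.
rewrite -!cardsX -(card_imset _ cyclic_pair_inj) subset_leq_card //.
apply/fintype.subsetP => _ /imsetP[[g w] /finset.setXP[_ gw] ->].
rewrite !inE in gw; rewrite finset.in_setX !inE andbT /=.
by rewrite (good_cyclic_pair (g, w)).
Qed.

End MatrixCount.

(** * Sieving monic polynomials over a finite field *)

Section MonicPolys.
Variable F : fieldType.
Implicit Types p q : {poly F}.

Lemma monic_ofK n p : p \is monic -> size p = n.+1 ->
  monic_of (poly_rV (p - 'X^n) : 'rV_n) = p.
Proof.
move=> mp sp; rewrite /monic_of poly_rV_K ?subrKC //.
apply/leq_sizeP => j nj; rewrite coefB coefXn.
move: nj; rewrite leq_eqVlt => /predU1P[<-|nj].
  by move: mp; rewrite monicE lead_coefE sp /= => /eqP ->; rewrite eqxx subrr.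
by rewrite gtn_eqF // nth_default ?sp // subrr.
Qed.

Lemma monic_of_inj n : injective (@monic_of F n).
Proof. by move=> u v /addrI /(can_inj (@rVpolyK _ _)). Qed.

Lemma coprimep_irr p q : p \is monic -> q \is monic ->
  irreducible_poly p -> irreducible_poly q -> p != q -> coprimep p q.
Proof.
move=> mp mq ip iq; apply: contraNT.
rewrite irreducible_poly_coprime // negbK => pq.
have /(iq _)/(_ pq) : size p != 1%N by have [sp _] := ip; rewrite gtn_eqF.
by rewrite eqp_monic.
Qed.

End MonicPolys.

(** Strong induction on the size: normalize [q] if it is irreducible, otherwise descend to a proper
    nonconstant divisor. *)
Lemma irr_factor (F : finFieldType) (q : {poly F}) : (1 < size q)%N ->
  exists p : {poly F}, [/\ p \is monic, irreducible_poly p & p %| q].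
Proof.
have [k] := ubnP (size q); elim: k q => // k IH q; rewrite ltnS => sqk sq.
have q0 : q != 0 by rewrite -size_poly_gt0 ltnW.
have lq0 : lead_coef q != 0 by rewrite lead_coef_eq0.
have [irrq|] := boolP (irreducibleb q).
  exists ((lead_coef q)^-1 *: q); rewrite monicE lead_coefZ mulVf //.
  rewrite dvdpZl ?invr_eq0 // dvdpp; split=> //.
  have [_ iq] := irreducibleP q irrq.
  split=> [|p sp]; first by rewrite size_scale ?invr_eq0.
  rewrite dvdpZr ?invr_eq0 // => /(iq _ sp).
  by rewrite (eqp_rtrans (eqp_scale q (invr_neq0 lq0))).
rewrite /irreducibleb sq /= negb_forall => /existsP[[g /= sg]].
rewrite negb_imply -ltnNge -Pdiv.Idomain.dvdpE => /andP[gq sg1].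
have [|p [mp ip pg]] := IH _ _ sg1.
  by apply: leq_trans sqk; apply: leq_ltn_trans sg _; rewrite prednK // ltnW.
by exists p; split=> //; apply: dvdp_trans gq.
Qed.

Section FreeCount.
Variable F : finFieldType.
Implicit Types (Q p : {poly F}) (Is : seq {poly F}).

Definition free_count Is n :=
  #|[set w : 'rV[F]_n | all (fun Q => coprimep Q (monic_of w)) Is]|.

(** A polynomial prime to [Is] is either prime to [Q] or of the form [Q * g]. As [Q] is itself prime
    to [Is], the second kind corresponds to the monic [g] prime to [Is] of complementary degree. *)
Lemma free_count_cons Q Is n :
    Q \is monic -> irreducible_poly Q -> {in Is, forall P, coprimep P Q} ->
  free_count Is n = (free_count (Q :: Is) n +
    (if (size Q).-1 <= n then free_count Is (n - (size Q).-1) else 0))%N.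
Proof.
move=> mQ iQ cQ; set d := (size Q).-1.
have sQ : size Q = d.+1 by rewrite prednK // ltnW; have [] := iQ.
rewrite {1}/free_count -(cardsID [set w | coprimep Q (monic_of w)]); congr (_ + _)%N.
  by apply: eq_card => w; rewrite !inE /= andbC.
case: leqP => [dn|nd]; last first.
  apply/eqP; rewrite cards_eq0; apply/eqP/setP => w; rewrite !inE.
  rewrite irreducible_poly_coprime // negbK; apply/negP => /andP[Qw _].
  have := dvdp_leq (monic_neq0 (monic_of_monic w)) Qw.
  by rewrite size_monic_of sQ ltnS leqNgt nd.
pose h (u : 'rV[F]_(n - d)) : 'rV[F]_n := poly_rV (Q * monic_of u - 'X^n).
have hE u : monic_of (h u) = Q * monic_of u.
  rewrite monic_ofK ?monicMl ?monic_of_monic // size_monicM // ?monic_neq0 //.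
    by rewrite sQ size_monic_of addSn /= addnS subnKC.
  exact: monic_of_monic.
have h_inj : injective h.
  move=> u v /(congr1 (@monic_of _ _)); rewrite !hE.
  by move/(mulfI (monic_neq0 mQ))/monic_of_inj.
rewrite /free_count -(card_imset _ h_inj).
apply: eq_card => w; rewrite !inE irreducible_poly_coprime // negbK.
apply/andP/imsetP => [[/dvdpP[g wE] aw]|[u]].
  have g0 : g != 0.
    apply: contraTneq (monic_neq0 (monic_of_monic w)) => g0.
    by rewrite wE g0 mul0r eqxx.
  have mg : g \is monic by move: (monic_of_monic w); rewrite wE monicMr.
  have sg : size g = (n - d).+1.
    have := size_monic_of w; rewrite wE size_Mmonic // sQ addnS /= => E.
    by rewrite -subSn // -E addnK.
  exists (poly_rV (g - 'X^(n - d))); last first.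
    by apply: monic_of_inj; rewrite hE monic_ofK // wE mulrC.
  rewrite inE monic_ofK //; apply/allP => P PI.
  by move/allP/(_ P PI): aw; rewrite wE coprimepMr => /andP[].
rewrite inE => au ->; rewrite hE dvdp_mulr //; split=> //.
apply/allP => P PI; rewrite coprimepMr cQ //=.
exact: (allP au).
Qed.

Definition irrs e : seq {poly F} :=
  [seq p <- [seq monic_of w | w : 'rV[F]_e] | irreducibleb p].

Lemma mem_irrs e Q :
  (Q \in irrs e) = [&& Q \is monic, irreducibleb Q & size Q == e.+1].
Proof.
rewrite mem_filter andbCA; congr (_ && _).
apply/mapP/andP => [[w _ ->]|[mQ /eqP sQ]].
  by rewrite monic_of_monic size_monic_of.
by exists (poly_rV (Q - 'X^e)); rewrite ?mem_enum // monic_ofK.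
Qed.

Lemma irrs_uniq e : uniq (irrs e).
Proof.
by rewrite filter_uniq // map_inj_uniq ?enum_uniq //; exact: monic_of_inj.
Qed.

Lemma size_irrs e :
  size (irrs e) = #|[set w : 'rV[F]_e | irreducibleb (monic_of w)]|.
Proof.
rewrite size_filter count_map enumT cardsE cardE /enum_mem size_filter.
exact: eq_count.
Qed.

Definition irrs_of (D : seq nat) := flatten [seq irrs e | e <- D].

Lemma irrs_ofP D Q : reflect (exists2 e, e \in D & Q \in irrs e) (Q \in irrs_of D).
Proof. exact: (iffP flatten_mapP). Qed.

Lemma irrs_of_uniq D : uniq D -> uniq (irrs_of D).
Proof.
elim: D => [//|e D IH] /= /andP[eD uD].
rewrite /irrs_of /= cat_uniq irrs_uniq IH // andbT.
apply/hasPn => Q /irrs_ofP[e' e'D]; rewrite mem_irrs => /and3P[_ _ /eqP sQ].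
apply: contra eD; rewrite mem_irrs sQ eqSS => /and3P[_ _ /eqP <-] //.
Qed.

Section Real.
Variable R : numFieldType.

Definition psum n (p : {poly R}) : R := \sum_(k < n.+1) p`_k.

(** The counterpart of [free_count_cons] for coefficient sums: multiplication by [X^d] shifts the
    cutoff by [d], and nothing remains when [n < d]. *)
Lemma psumMX n (p : {poly R}) a d :
  psum n (p * (1 - a *: 'X^d)) =
  psum n p - a * (if (d <= n)%N then psum (n - d) p else 0).
Proof.
rewrite mulrBr mulr1 -scalerAr /psum.
under eq_bigr do rewrite coefB coefZ coefMXn.
rewrite big_split /= sumrN -mulr_sumr; congr (_ - _ * _).
case: leqP => [dn|nd]; last first.
  by apply: big1 => i _; rewrite (leq_ltn_trans _ nd) // -ltnS.
rewrite -(big_mkord xpredT (fun i => if (i < d)%N then 0 else p`_(i - d))).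
rewrite (big_cat_nat (n := d)) //=; last by rewrite leqW.
rewrite big_nat_cond big1 ?add0r; last by move=> i /andP[/andP[_ ->]].
rewrite -{1}[d]add0n big_addn subSn // big_mkord.
by apply: eq_bigr => i _; rewrite ltnNge leq_addl /= addnK.
Qed.

Definition euler_factor (e : nat) : {poly R} :=
  1 - (#|F|%:R ^- e) *: 'X^e.

(** Induction on [Is]: adding [Q] acts on both sides by the same recurrence, from [free_count_cons]
    and from [psumMX] with [a = #|F| ^- deg Q]. *)
Lemma free_countE Is n : uniq Is ->
  {in Is, forall P, P \is monic /\ irreducible_poly P} ->
  (free_count Is n)%:R / #|F|%:R ^+ n =
  psum n (\prod_(Q <- Is) euler_factor (size Q).-1).
Proof.
have q0 : #|F|%:R != 0 :> R.
  by rewrite pnatr_eq0 -lt0n; apply/card_gt0P; exists 0.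
elim: Is n => [|Q Is IH] n.
  move=> _ _; rewrite big_nil /psum big_ord_recl coef1 /= big1 ?addr0.
    rewrite /free_count (_ : [set w | _] = [set: _]%SET); last first.
      by apply/setP => w; rewrite !inE.
    by rewrite cardsT card_mx mul1n natrX divff // expf_neq0.
  by move=> i _; rewrite coef1.
rewrite cons_uniq => /andP[QI uI] HI.
have [mQ iQ] := HI Q (mem_head _ _).
have HI' : {in Is, forall P, P \is monic /\ irreducible_poly P}.
  by move=> P PI; apply: HI; rewrite inE PI orbT.
have cQ : {in Is, forall P, coprimep P Q}.
  move=> P PI; have [mP iP] := HI' P PI; apply: coprimep_irr => //.
  by apply: contraNneq QI => <-.
rewrite big_cons [euler_factor _ * _]mulrC {1}/euler_factor psumMX -(IH n) //.
rewrite (free_count_cons n mQ iQ cQ) natrD mulrDl; case: leqP => dn; last first.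
  by rewrite mul0r addr0 mulr0 subr0.
have -> : #|F|%:R ^+ n = #|F|%:R ^+ (size Q).-1 * #|F|%:R ^+ (n - (size Q).-1) :> R.
  by rewrite -exprD subnKC.
rewrite -IH //; set x := _ ^+ _; set y := _ ^+ _.
have x0 : x != 0 by rewrite expf_neq0.
have y0 : y != 0 by rewrite expf_neq0.
by field; rewrite x0 y0.
Qed.

Lemma free_count_irrs_of D n : uniq D ->
  (free_count (irrs_of D) n)%:R / #|F|%:R ^+ n =
  psum n (\prod_(e <- D) euler_factor e ^+ size (irrs e)).
Proof.
move=> uD; rewrite free_countE ?irrs_of_uniq //; last first.
  by move=> Q /irrs_ofP[e _]; rewrite mem_irrs => /and3P[? /irreducibleP ? _].
congr psum; rewrite big_flatten /= big_map; apply: eq_bigr => e _.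
rewrite big_seq (eq_bigr (fun=> euler_factor e)); last first.
  by move=> Q; rewrite mem_irrs => /and3P[_ _ /eqP ->].
by rewrite -big_seq big_const_seq count_predT iter_mulr_1.
Qed.

End Real.

Lemma size_irrs_free d : (0 < d)%N ->
  size (irrs d) = free_count (irrs_of (iota 1 d.-1)) d.
Proof.
move=> d0; rewrite size_irrs; apply: eq_card => w; rewrite !inE.
apply/idP/allP => [/irreducibleP iw Q /irrs_ofP[e]|H].
  rewrite mem_iota mem_irrs => /andP[e0 ed] /and3P[_ /irreducibleP iQ /eqP sQ].
  rewrite coprimep_sym irreducible_poly_coprime //.
  apply/negP => /dvdp_leq; rewrite size_monic_of sQ irredp_neq0 // => /(_ isT).
  by lia.
rewrite /irreducibleb size_monic_of ltnS d0 /=.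
(* A divisor [g] of positive degree below [d] would supply an irreducible factor belonging to the
   list. *)
apply/forallP => -[g /= sg]; apply/implyP; rewrite -Pdiv.Idomain.dvdpE => gw.
rewrite leqNgt; apply/negP => /irr_factor[p [mp ip pg]].
have pw : p %| monic_of w by apply: dvdp_trans gw.
have g0 : g != 0.
  apply: contraTneq gw => ->; rewrite dvd0p.
  exact: monic_neq0 (monic_of_monic w).
have sp := dvdp_leq g0 pg.
have [sp1 _] := ip.
suff : p \in irrs_of (iota 1 d.-1).
  by move/H; rewrite irreducible_poly_coprime // pw.
apply/irrs_ofP; exists (size p).-1.
  have spd : (size p <= d)%N := leq_trans sp sg.
  by rewrite mem_iota; move: sp1 spd d0; case: (size p) => [|[|k]]; lia.
by rewrite mem_irrs mp prednK ?eqxx ?andbT ?(ltnW sp1) //; apply/irreducibleP.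
Qed.

End FreeCount.

Local Open Scope classical_set_scope.
Local Open Scope ring_scope.

(** * Coefficientwise limits *)

Section CvgBig.
Context {R : realType} {T : Type} {F : set_system T} {FF : Filter F}.

Lemma cvg_sum_seq (I : Type) (r : seq I) (f : I -> T -> R) (l : I -> R) :
  (forall i, f i t @[t --> F] --> l i) ->
  \sum_(i <- r) f i t @[t --> F] --> \sum_(i <- r) l i.
Proof.
move=> fl; elim: r => [|i r IH].
  by rewrite big_nil; under eq_cvg do rewrite big_nil; exact: cvg_cst.
by rewrite big_cons; under eq_cvg do rewrite big_cons; exact: cvgD.
Qed.

Lemma cvg_prod_seq (I : eqType) (r : seq I) (f : I -> T -> R) (l : I -> R) :
  {in r, forall i, f i t @[t --> F] --> l i} ->
  \prod_(i <- r) f i t @[t --> F] --> \prod_(i <- r) l i.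
Proof.
elim: r => [|i r IH] fl.
  by rewrite big_nil; under eq_cvg do rewrite big_nil; exact: cvg_cst.
rewrite big_cons; under eq_cvg do rewrite big_cons.
apply: cvgM; first by apply: fl; rewrite mem_head.
by apply: IH => j jr; apply: fl; rewrite inE jr orbT.
Qed.

(** A coefficient of degree [k] of a product involves only coefficients of degree at most [k], so
    the degrees of the [p i t] may grow with [t]. *)
Lemma cvg_coef_prod (I : eqType) (r : seq I) (p : I -> T -> {poly R})
    (q : I -> {poly R}) n :
  {in r, forall i k, (k <= n)%N -> (p i t)`_k @[t --> F] --> (q i)`_k} ->
  forall k, (k <= n)%N ->
    (\prod_(i <- r) p i t)`_k @[t --> F] --> (\prod_(i <- r) q i)`_k.
Proof.
elim: r => [|i r IH] pq k kn.
  by rewrite big_nil; under eq_cvg do rewrite big_nil; exact: cvg_cst.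
rewrite big_cons; under eq_cvg do rewrite big_cons coefM.
rewrite coefM; apply: cvg_sum_seq => j.
apply: cvgM; first by apply: pq; rewrite ?mem_head // (leq_trans _ kn) // -ltnS.
apply: IH; last by rewrite (leq_trans _ kn) // leq_subr.
by move=> i' ir; apply: pq; rewrite inE ir orbT.
Qed.

Lemma cvg_psum n (p : T -> {poly R}) (q : {poly R}) :
  (forall k, (k <= n)%N -> (p t)`_k @[t --> F] --> q`_k) ->
  psum n (p t) @[t --> F] --> psum n q.
Proof.
by move=> pq; apply: cvg_sum_seq => k; apply: pq; rewrite -ltnS.
Qed.

End CvgBig.

(** * Truncated exponentials as limits of powers *)

Section ExpPoly.
Variable R : realType.

Lemma coef_sumXM (c : nat -> R) e m k : (0 < e)%N ->
  (\sum_(i < m) c i *: 'X^(e * i))`_k =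
  if (e %| k)%N && (k %/ e < m)%N then c (k %/ e)%N else 0.
Proof.
move=> e0; rewrite coef_sum.
under eq_bigr do rewrite coefZ coefXn.
case: ifPn => [/andP[/dvdnP[i ->]]|].
  rewrite mulnK // => im; rewrite (bigD1 (Ordinal im)) //= mulnC eqxx mulr1.
  rewrite big1 ?addr0 // => j; apply: contraNeq.
  rewrite mulf_eq0 negb_or pnatr_eq0 eqb0 negbK eqn_pmul2l //.
  by case/andP=> _ /eqP E; apply/eqP/val_inj.
move=> H; apply: big1 => i _; case: eqP => [E|_]; last by rewrite mulr0.
by move: H; rewrite E dvdn_mulr // mulKn // ltn_ord.
Qed.

(* Truncation of exp(-X^e / e). *)
Definition expp (e n : nat) : {poly R} :=
  \sum_(i < n.+1) ((- e%:R^-1) ^+ i / i`!%:R) *: 'X^(e * i).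

(** The Poisson limit of binomial coefficients, by induction through
    [(i+1) C(N, i+1) = (N - i) C(N, i)]. *)
Lemma cvg_bin (T : Type) (F : set_system T) (FF : Filter F)
    (N : T -> nat) (y : T -> R) (l : R) i :
  y t @[t --> F] --> 0 -> (N t)%:R * y t @[t --> F] --> l ->
  (- y t) ^+ i * 'C(N t, i)%:R @[t --> F] --> (- l) ^+ i / i`!%:R.
Proof.
move=> y0 yl; elim: i => [|i IH].
  rewrite expr0 fact0 divr1; under eq_cvg do rewrite expr0 bin0 mulr1.
  exact: cvg_cst.
(* The null term [i%:R * 0] is the limit of [i%:R * y t] in [E]. *)
have -> : (- l) ^+ i.+1 / i.+1`!%:R =
    ((- l) ^+ i / i`!%:R) * (- (l - i%:R * 0)) * i.+1%:R^-1.
  rewrite factS natrM mulr0 subr0 exprS invfM; ring.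
have E t : (- y t) ^+ i.+1 * 'C(N t, i.+1)%:R =
    ((- y t) ^+ i * 'C(N t, i)%:R) * (- ((N t)%:R * y t - i%:R * y t)) * i.+1%:R^-1.
  (* The subtraction is the real one; when [N t < i] both binomials vanish. *)
  have : i.+1%:R * 'C(N t, i.+1)%:R = ((N t)%:R - i%:R) * 'C(N t, i)%:R :> R.
    rewrite -natrM mul_bin_left natrM; case: (leqP i (N t)) => iN.
      by rewrite natrB.
    by rewrite bin_small // !mulr0.
  move/(canRL (mulKf _)) => -> //; rewrite exprS; ring.
under eq_cvg do rewrite E.
apply: cvgMr_tmp; apply: cvgM => //; apply: cvgN; apply: cvgB => //.
exact: cvgMl_tmp.
Qed.

(** By the binomial theorem at most one term has degree [k], and [cvg_bin] gives its limit. The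
    cutoff of [expp] at [n] is invisible in degrees [k <= n]. *)
Lemma cvg_coef_binomial (T : Type) (F : set_system T) (FF : Filter F)
    (N : T -> nat) (y : T -> R) e n k : (0 < e)%N -> (k <= n)%N ->
  y t @[t --> F] --> 0 -> (N t)%:R * y t @[t --> F] --> (e%:R^-1 : R) ->
  ((1 - y t *: 'X^e) ^+ N t)`_k @[t --> F] --> (expp e n)`_k.
Proof.
move=> e0 kn y0 yl.
have E t : ((1 - y t *: 'X^e) ^+ N t)`_k =
    if (e %| k)%N then (- y t) ^+ (k %/ e) * 'C(N t, k %/ e)%:R else 0.
  have -> : (1 - y t *: 'X^e) ^+ N t =
      \sum_(i < (N t).+1) ((- y t) ^+ i * 'C(N t, i)%:R) *: 'X^(e * i).
    rewrite -scaleNr exprDn; apply: eq_bigr => i _.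
    by rewrite expr1n mul1r exprZn -exprM scalerMnl mulr_natr.
  rewrite (coef_sumXM (fun i => (- y t) ^+ i * 'C(N t, i)%:R)) //.
  case: (_ %| _)%N => //=; rewrite ltnS; case: leqP => // H.
  by rewrite bin_small // mulr0.
under eq_cvg do rewrite E.
rewrite (coef_sumXM (fun i => (- e%:R^-1) ^+ i / i`!%:R)) //.
have -> : (k %/ e < n.+1)%N by rewrite ltnS (leq_trans (leq_div _ _)).
rewrite andbT; case: ifP => _; last exact: cvg_cst.
exact: cvg_bin.
Qed.

Lemma expp_coef0 e n : (0 < e)%N -> (expp e n)`_0 = 1.
Proof.
move=> e0; rewrite (coef_sumXM (fun i => (- e%:R^-1) ^+ i / i`!%:R)) //.
by rewrite dvdn0 div0n /= expr0 fact0 divr1.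
Qed.

(** The differential equation [E' = - X^(e-1) E] of [exp(- X^e / e)], which the truncation satisfies
    modulo [X^n]. *)
Lemma expp_deriv e n : (0 < e)%N ->
  exists H, (expp e n)^`() = - 'X^(e.-1) * expp e n + 'X^n * H.
Proof.
(* The derivative misses the product of [X^(e-1)] with the last term of [expp]; [H] is that product
   divided by [X^n]. *)
move=> e0; exists (((- e%:R^-1) ^+ n / n`!%:R) *: 'X^(e.-1 + (e * n - n))).
have E : (expp e n)^`() = - 'X^(e.-1) *
    \sum_(i < n) ((- e%:R^-1) ^+ i / i`!%:R) *: 'X^(e * i).
  rewrite /expp linear_sum big_ord_recl /= muln0 expr0 derivZ derivC scaler0 add0r.
  rewrite mulr_sumr; apply: eq_bigr => i _.
  rewrite derivZ derivXn -scalerAr mulNr -exprD /bump /= add1n.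
  have -> : (e * i.+1).-1 = (e.-1 + e * i)%N by rewrite mulnS; lia.
  rewrite scalerN -scaleNr -scalerMnr scalerMnl; congr (_ *: _).
  rewrite -mulr_natr factS !natrM exprS invfM.
  have e0' : e%:R != 0 :> R by rewrite pnatr_eq0 -lt0n.
  by field; rewrite e0' nat1r !pnatr_eq0 -lt0n fact_gt0.
rewrite E /expp big_ord_recr /= mulrDr -addrA -[LHS]addr0; congr (_ + _).
rewrite -!scalerAr mulNr -!exprD scalerN.
by rewrite addnCA subnKC ?leq_pmull // addNr.
Qed.

Lemma prod_expp_deriv (D : seq nat) n : all (leq 1) D ->
  exists H, (\prod_(e <- D) expp e n)^`() =
    - (\sum_(e <- D) 'X^(e.-1)) * \prod_(e <- D) expp e n + 'X^n * H.
Proof.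
elim: D => [_|e D IH /= /andP[e0 /IH[H EH]]].
  by exists 0; rewrite !big_nil derivC oppr0 mul0r mulr0 addr0.
have [H' EH'] := expp_deriv n e0.
exists (H' * (\prod_(e <- D) expp e n) + expp e n * H).
by rewrite !big_cons derivM EH EH'; ring.
Qed.

Lemma prod_expp_coef0 (D : seq nat) n : all (leq 1) D ->
  (\prod_(e <- D) expp e n)`_0 = 1.
Proof.
elim: D => [_|e D IH /= /andP[e0 /IH E]]; first by rewrite big_nil coef1.
by rewrite big_cons coef0M E expp_coef0 // mul1r.
Qed.

Lemma psumS n (p : {poly R}) : psum n.+1 p = psum n p + p`_n.+1.
Proof. by rewrite /psum big_ord_recr. Qed.

(* Modulo X^d the product G satisfies G' = -(1 + X + ... + X^(d-2)) G; hence
   m * psum m G = (m - 1) * psum (m - 1) G + [m = d] for 0 < m <= d. *)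
Lemma psum_prod_expp d : (0 < d)%N ->
  psum d (\prod_(e <- iota 1 d.-1) expp e d) = d%:R^-1.
Proof.
case: d => // d _ /=; set G := \prod_(e <- _) _.
have aD : all (leq 1) (iota 1 d) by apply/allP => e; rewrite mem_iota => /andP[].
have G0 : G`_0 = 1 by exact: prod_expp_coef0.
have [H EH] := prod_expp_deriv d.+1 aD; rewrite -/G in EH.
have SE : \sum_(e <- iota 1 d) 'X^(e.-1) = \poly_(i < d) 1 :> {poly R}.
  rewrite poly_def -[iota 1 d]/(iota (0 + 1) d) addnC iotaDl big_map.
  rewrite -(big_mkord xpredT (fun i => 1 *: 'X^i)) /index_iota subn0.
  by apply: eq_bigr => i _; rewrite scale1r.
(* Coefficient of [X^m] in the differential equation. After the case analysis the geometric sum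
   stops at [X^(d-1)], so at [m = d] the coefficient [G_0 = 1] is left out of the partial sum. *)
have A m : (m <= d)%N -> m.+1%:R * G`_m.+1 = (m == d)%:R - psum m G.
  move=> md; have := congr1 (fun p : {poly R} => p`_m) EH => /=.
  rewrite coef_deriv mulr_natl => ->; rewrite coefD coefXnM ltnS md addr0.
  rewrite mulNr coefN mulrC SE coefM.
  case: eqP md => [-> _|/eqP md1 md2].
    rewrite /psum !big_ord_recl /= subn0 coef_poly ltnn mulr0 add0r G0.
    rewrite opprD addrA subrr add0r.
    congr (- _); apply: eq_bigr => i _; rewrite coef_poly.
    by rewrite /bump /= add1n ltn_subrL /= (leq_ltn_trans _ (ltn_ord i)) // mulr1.
  rewrite sub0r; congr (- _); apply: eq_bigr => i _; rewrite coef_poly.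
  rewrite ifT ?mulr1 // (leq_ltn_trans (leq_subr _ _)) // ltn_neqAle md1 //.
have B m : (m <= d.+1)%N -> m%:R * psum m G = (m == d.+1)%:R.
  elim: m => [|m IH] md; first by rewrite mul0r.
  rewrite psumS mulrDr A // eqSS -[m.+1]addn1 natrD mulrDl IH; last exact: ltnW.
  by rewrite ltn_eqF // mul1r add0r addrC subrK.
have := B d.+1 (leqnn _); rewrite eqxx => /(canRL (mulKf _)) -> //.
by rewrite mulr1.
Qed.

End ExpPoly.

(** * Evaluation at 1 and the limit of the partial sums *)

Section LimitExp.
Variable R : realType.
Implicit Types P Q : {poly R}.

(** Truncation of [exp(X^e / e)], a coefficientwise majorant of [expp]. *)
Definition abs_expp (e n : nat) : {poly R} :=
  \sum_(i < n.+1) ((e%:R^-1) ^+ i / i`!%:R) *: 'X^(e * i).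

Lemma prod_expp_le (D : seq nat) n k : all (leq 1) D ->
  `|(\prod_(e <- D) expp R e n)`_k| <= (\prod_(e <- D) abs_expp e n)`_k.
Proof.
elim: D k => [|e D IH] k.
  by rewrite !big_nil coef1 normr_nat.
move=> /= /andP[e0 aD]; rewrite !big_cons !coefM.
apply: le_trans (ler_norm_sum _ _ _) _; apply: ler_sum => i _.
rewrite normrM ler_pM //; last exact: IH.
rewrite (coef_sumXM (fun i => (- e%:R^-1) ^+ i / i`!%:R)) //.
rewrite (coef_sumXM (fun i => (e%:R^-1) ^+ i / i`!%:R)) //.
case: ifP => _; last by rewrite normr0.
by rewrite normrM normrX normrN !normfV !normr_nat.
Qed.

(** For [k > n] each [|P_k|] is at most [Q_k 2^k / 2^n]; evaluating the majorant at 2 thus gives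
    geometric decay. *)
Lemma psum_tail n P Q : (forall k, `|P`_k| <= Q`_k) ->
  `|P.[1] - psum n P| <= Q.[2] / 2 ^+ n.
Proof.
move=> PQ; pose M := (size P + size Q + n.+1)%N.
have Q0 k : 0 <= Q`_k by apply: le_trans (PQ k).
have sP : (size P <= M)%N by rewrite /M; lia.
have sQ : (size Q <= M)%N by rewrite /M; lia.
have nM : (n.+1 <= M)%N by rewrite /M; lia.
rewrite (horner_coef_wide _ sP) (horner_coef_wide _ sQ) /psum.
under eq_bigr do rewrite expr1n mulr1.
rewrite -!(big_mkord xpredT (fun k => P`_k)).
rewrite -(big_mkord xpredT (fun k => Q`_k * 2 ^+ k)).
rewrite (big_cat_nat (n := n.+1) (leq0n _) nM) /= addrAC subrr add0r.
rewrite mulr_suml (big_cat_nat (n := n.+1) (leq0n _) nM) /=.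
apply: le_trans (ler_norm_sum _ _ _) _.
rewrite -[leLHS]add0r lerD //.
  by apply: sumr_ge0 => k _; rewrite divr_ge0 ?mulr_ge0 // exprn_ge0.
apply: ler_sum_nat => k /andP[nk _]; apply: le_trans (PQ k) _.
rewrite -mulrA ler_peMr // -exprB ?unitfE // ?(ltnW nk) //.
by rewrite exprn_ege1 // ler1n.
Qed.

Lemma expp_horner1 e n :
  (expp R e n).[1] = series (exp_coeff (- e%:R^-1)) n.+1.
Proof.
rewrite /expp horner_sum /series /= big_mkord; apply: eq_bigr => i _.
by rewrite hornerZ hornerXn expr1n mulr1.
Qed.

Lemma abs_expp_horner2 e n :
  0 <= (abs_expp e n).[2] <= expR (2 ^+ e / e%:R).
Proof.
have -> : (abs_expp e n).[2] = series (exp_coeff (2 ^+ e / e%:R)) n.+1.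
  rewrite /abs_expp horner_sum /series /= big_mkord; apply: eq_bigr => i _.
  by rewrite hornerZ hornerXn exprM /exp_coeff /= exprMn; ring.
have x0 : 0 <= 2 ^+ e / e%:R :> R by rewrite divr_ge0 // exprn_ge0.
apply/andP; split.
  by apply: sumr_ge0 => i _; exact: exp_coeff_ge0.
apply: nondecreasing_cvgn_le; last exact: is_cvg_series_exp_coeff.
apply/nondecreasing_seqP => k.
by rewrite !seriesEnat /= big_nat_recr //= lerDl exp_coeff_ge0.
Qed.

(** The value at 1 is a product of partial sums of exponential series, so its limit is known; it
    differs from [psum n] by a tail that [psum_tail] controls. *)
Lemma cvg_psum_prod_expp (D : seq nat) : all (leq 1) D ->
  psum n (\prod_(e <- D) expp R e n) @[n --> \oo] -->
  (\prod_(e <- D) expR (- e%:R^-1) : R).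
Proof.
move=> aD; pose P n := \prod_(e <- D) expp R e n.
have P1 : (P n).[1] @[n --> \oo] --> (\prod_(e <- D) expR (- e%:R^-1) : R).
  under eq_cvg do rewrite /P horner_prod.
  apply: cvg_prod_seq => e _; under eq_cvg do rewrite expp_horner1.
  have : series (exp_coeff (- e%:R^-1)) @ \oo --> (expR (- e%:R^-1) : R).
    exact: is_cvg_series_exp_coeff.
  by rewrite -cvg_shiftS.
(* Bounds the majorant at 2 uniformly in [n]. *)
pose C : R := \prod_(e <- D) expR (2 ^+ e / e%:R).
have tail0 : (P n).[1] - psum n (P n) @[n --> \oo] --> (0 : R).
  apply/norm_cvg0P.
  apply: (@squeeze_cvgr _ _ _ _ (fun=> 0) (fun n => C * (2^-1) ^+ n)).
  - near=> n; rewrite normr_ge0 /=.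
    apply: le_trans (psum_tail n (Q := \prod_(e <- D) abs_expp e n) _) _.
      by move=> k; exact: prod_expp_le.
    rewrite exprVn ler_wpM2r ?invr_ge0 ?exprn_ge0 // horner_prod.
    by apply: ler_prod => e _; exact: abs_expp_horner2.
  - exact: cvg_cst.
  - by apply: cvg_geometric; rewrite ger0_norm ?invr_ge0 // invf_lt1 // ltr1n.
rewrite -[X in _ --> X]subr0.
under eq_cvg => n do rewrite -[psum _ _](subKr ((P n).[1])).
exact: cvgB.
Unshelve. all: by end_near. Qed.

End LimitExp.

(** * Limits along the primes *)

Section PrimeLimits.
Variable R : realType.

Definition near_primes : set_system nat := within [set p : nat | prime p] \oo.

Global Instance near_primes_filter : Filter near_primes.
Proof. exact: within_filter. Qed.

(** Equal to [p] at primes and nonzero for every [p], so quotients by its powers can be handled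
    without a primality proof. *)
Definition qF (p : nat) : R := #|'F_p|%:R.

Lemma qF_neq0 p : qF p != 0.
Proof. by rewrite pnatr_eq0 -lt0n; apply/card_gt0P; exists 0. Qed.

Lemma cvg_qFV : (qF p)^-1 @[p --> near_primes] --> (0 : R).
Proof.
apply: cvg_trans (_ : (p%:R)^-1 @[p --> near_primes] --> (0 : R)); last first.
  apply: cvg_within_filter; apply/gtr0_cvgV0; last exact: cvgr_idn.
  by exists 1%N => // n /= n0; rewrite ltr0n.
by apply: near_eq_cvg; exists 0%N => // p _ pp; rewrite /qF card_Fp.
Qed.

Lemma cvg_qFVX e : (0 < e)%N -> (qF p) ^- e @[p --> near_primes] --> (0 : R).
Proof.
case: e => // e _; elim: e => [|e IH].
  by under eq_cvg do rewrite expr1; exact: cvg_qFV.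
have := cvgM cvg_qFV IH; rewrite mulr0.
by under eq_cvg do rewrite /= -invfM -exprS; apply.
Qed.

Lemma cvg_free_count (D : seq nat) n : uniq D -> all (leq 1) D ->
  {in D, forall e, (size (irrs 'F_p e))%:R / qF p ^+ e
    @[p --> near_primes] --> (e%:R^-1 : R)} ->
  (free_count (irrs_of 'F_p D) n)%:R / qF p ^+ n @[p --> near_primes] -->
  psum n (\prod_(e <- D) expp R e n).
Proof.
move=> uD aD HD; under eq_cvg do rewrite /qF free_count_irrs_of //.
apply: cvg_psum => k kn.
apply: (cvg_coef_prod (n := n)) => // e eD i iN.
have e0 := allP aD e eD.
by apply: cvg_coef_binomial => //; [exact: cvg_qFVX|exact: HD].
Qed.

(** Strong induction: [size_irrs_free] sieves by the degrees below [d], whose limits are known, and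
    [psum_prod_expp] evaluates the result. *)
Lemma cvg_size_irrs d : (0 < d)%N ->
  (size (irrs 'F_p d))%:R / qF p ^+ d @[p --> near_primes] --> (d%:R^-1 : R).
Proof.
have [k] := ubnP d; elim: k d => // k IH d; rewrite ltnS => dk d0.
under eq_cvg do rewrite size_irrs_free //.
rewrite -psum_prod_expp //; apply: cvg_free_count; first exact: iota_uniq.
  by apply/allP => e; rewrite mem_iota => /andP[].
move=> e; rewrite mem_iota => /andP[e0 ed]; apply: IH => //.
by apply: leq_trans dk; lia.
Qed.

Lemma card_GL_ratio (F : finFieldType) n :
  #|'GL_n.+1[F]%g|%:R / #|F|%:R ^+ (n.+1 * n.+1) =
  \prod_(1 <= i < n.+2) (1 - #|F|%:R ^- i) :> R.
Proof.
have q1 : (0 < #|F|)%N by apply/card_gt0P; exists 0.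
have q0 : #|F|%:R != 0 :> R by rewrite pnatr_eq0 -lt0n.
rewrite card_GL // natrM natrX natr_prod.
have -> : \prod_(1 <= i < n.+2) (#|F| ^ i - 1)%:R =
    #|F|%:R ^+ 'C(n.+2, 2) * \prod_(1 <= i < n.+2) (1 - #|F|%:R ^- i) :> R.
  have -> : 'C(n.+2, 2) = (\sum_(1 <= i < n.+2) i)%N by rewrite -bin2_sum big_ltn.
  rewrite -prodrXr -big_split /=.
  apply: eq_bigr => i _; rewrite natrB ?expn_gt0 ?q1 // natrX.
  by rewrite mulrBr mulr1 divff // expf_neq0.
rewrite mulrA -exprD.
(* The powers [q^i] taken out of the factors [q^i - 1] complete the exponent to a square. *)
have -> : ('C(n.+1, 2) + 'C(n.+2, 2) = n.+1 * n.+1)%N.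
  by have := mul_bin_diag n.+1 1; rewrite (binS n.+1) !bin1 /=; nia.
by rewrite mulrAC divff ?mul1r // expf_neq0.
Qed.

Lemma cvg_card_GL n :
  #|'GL_n.+1['F_p]%g|%:R / qF p ^+ (n.+1 * n.+1) @[p --> near_primes] --> (1 : R).
Proof.
have E : \prod_(1 <= i < n.+2) (1 - 0) = 1 :> R by rewrite subr0 big1.
rewrite -[X in _ --> X]E; under eq_cvg do rewrite /qF card_GL_ratio.
apply: cvg_prod_seq => i; rewrite mem_index_iota => /andP[i0 _].
by apply: cvgB; [exact: cvg_cst|exact: cvg_qFVX].
Qed.

Lemma ler_frac (a b c x y : R) : 0 < x -> 0 < y ->
  a * b <= c * y -> a / x * (b / y) <= c / x.
Proof.
move=> x0 y0 H; rewrite mulf_div ler_pdivrMr ?mulr_gt0 //.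
by rewrite mulrA divfK ?gt_eqF.
Qed.

Lemma cvg_good_mx (D : seq nat) n : uniq D -> all (leq 1) D ->
  #|[set A : 'M['F_p]_n.+1 | good_mx (irrs_of 'F_p D) A]%SET|%:R
    / qF p ^+ (n.+1 * n.+1) @[p --> near_primes] -->
  psum n.+1 (\prod_(e <- D) expp R e n.+1).
Proof.
move=> uD aD; set L := psum _ _.
pose s p := (free_count (irrs_of 'F_p D) n.+1)%:R / qF p ^+ n.+1.
pose g p := #|'GL_n.+1['F_p]%g|%:R / qF p ^+ (n.+1 * n.+1).
have sL : s p @[p --> near_primes] --> L.
  by apply: cvg_free_count => // e eD; apply: cvg_size_irrs; exact: (allP aD).
have g1 : g p @[p --> near_primes] --> (1 : R) by exact: cvg_card_GL.
(* The bounds come from [card_good_mx_ge] and [card_bad_mx_ge]; as [g] tends to 1, both tend to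
   [L]. *)
apply: (@squeeze_cvgr _ _ _ _ (fun p => g p * s p)
   (fun p => 1 - g p * (1 - s p))).
- apply: nearW => p.
  have qp0 : 0 < qF p by rewrite lt0r qF_neq0 ler0n.
  have cm : (#|[set A : 'M['F_p]_n.+1 | good_mx (irrs_of 'F_p D) A]%SET|
      <= #|'F_p| ^ (n.+1 * n.+1))%N by rewrite -card_mx max_card.
  have cp : (free_count (irrs_of 'F_p D) n.+1 <= #|'F_p| ^ n.+1)%N.
    by rewrite -[n.+1 in leqRHS]mul1n -card_mx max_card.
  apply/andP; split.
    apply: ler_frac; rewrite ?exprn_gt0 //.
    by rewrite /qF -natrX -!natrM ler_nat; exact: card_good_mx_ge.
  rewrite lerBrDl -lerBrDr.
  have -> : 1 - s p =
      (#|'F_p| ^ n.+1 - free_count (irrs_of 'F_p D) n.+1)%N%:R / qF p ^+ n.+1.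
    by rewrite natrB // natrX mulrBl divff // expf_neq0 ?qF_neq0.
  have -> : 1 - #|[set A : 'M['F_p]_n.+1 | good_mx (irrs_of 'F_p D) A]%SET|%:R
    / qF p ^+ (n.+1 * n.+1) = (#|'F_p| ^ (n.+1 * n.+1) -
      #|[set A : 'M['F_p]_n.+1 | good_mx (irrs_of 'F_p D) A]%SET|)%N%:R
      / qF p ^+ (n.+1 * n.+1).
    by rewrite natrB // natrX mulrBl divff // expf_neq0 ?qF_neq0.
  apply: ler_frac; rewrite ?exprn_gt0 //.
  by rewrite /qF -natrX -!natrM ler_nat; exact: card_bad_mx_ge.
- by rewrite -[L]mul1r; exact: cvgM.
- rewrite -[L](subKr 1) -[X in 1 - X]mul1r; apply: cvgB; first exact: cvg_cst.
  by apply: cvgM => //; apply: cvgB => //; exact: cvg_cst.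
Qed.

End PrimeLimits.

(** * Reduction of p-adic matrices *)

Section Coker.
Variables (S : comNzRingType) (n : nat).

(** Preimages of the basis vectors form a right inverse of [M]; conversely the adjugate, scaled by
    [c], provides preimages. An explicit [c] expresses invertibility because [S] carries no unit
    predicate. *)
Lemma coker_eq0P (M : 'M[S]_n) :
  (forall x : coker M, x = 0) <-> exists c : S, \det M * c = 1.
Proof.
split=> [M0|[c Mc] x].
  have im v : exists w : 'cV[S]_n, v = M *m w.
    apply/asboolP; rewrite -[asbool _]/(v \in mximage M) -[v]subr0.
    by rewrite Quotient.idealrBE; apply/eqP; rewrite [LHS]M0 [RHS]M0.
  have [w Hw] := choice im.
  pose W := \matrix_(i, j) w (delta_mx j 0) i 0.
  exists (\det W); rewrite -det_mulmx (_ : M *m W = 1%:M) ?det1 //.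
  apply/matrixP => i j; rewrite mxE.
  have /(congr1 (fun v : 'cV_n => v i 0)) := Hw (delta_mx j 0).
  rewrite !mxE eqxx andbT => ->; apply: eq_bigr => k _; by rewrite mxE.
have : repr (x : Quotient.quot (mximage M)) - 0 \in mximage M.
  rewrite subr0; apply/asboolP.
  exists (c *: \adj M *m repr (x : Quotient.quot (mximage M))).
  by rewrite mulmxA -scalemxAr mul_mx_adj scale_scalar_mx mulrC Mc mul1mx.
by rewrite Quotient.idealrBE => /eqP; rewrite reprK => ->; exact: raddf0.
Qed.

End Coker.

Lemma prime_expS_gt1 (p : nat) (pp : prime p) k : (1 < p ^ k.+1)%N.
Proof. by rewrite -(exp1n k.+1) ltn_exp2r // prime_gt1. Qed.

Section ReduceMorphism.
Variables (p : nat) (pp : prime p).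
Local Notation Zp := (padic_int p).

Let p1 := prime_expS_gt1 pp.

Let val0D (x y : Zp) : nat_of_ord ((x + y)%R 0%N) = ((x 0%N + y 0%N) %% p)%N.
Proof. by congr (_ %% _)%N; rewrite Zp_cast // expn1. Qed.

Let val0M (x y : Zp) : nat_of_ord ((x * y)%R 0%N) = ((x 0%N * y 0%N) %% p)%N.
Proof. by congr (_ %% _)%N; rewrite Zp_cast // expn1. Qed.

Fact reduceD : {morph @reduce p : x y / x + y}.
Proof. by move=> x y; rewrite /reduce val0D Fp_nat_mod // natrD. Qed.

Fact reduce_zmod : zmod_morphism (@reduce p).
Proof.
move=> x y; apply/eqP; rewrite -subr_eq0 opprB addrA [in X in X == _]addrC addrA.
by rewrite -addrA -reduceD subrK addNr.
Qed.

Fact reduce_monoid : monoid_morphism (@reduce p).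
Proof.
split=> [|x y]; last by rewrite /reduce val0M Fp_nat_mod // natrM.
exact: mulr1n.
Qed.

End ReduceMorphism.

(* Carries the primality proof, on which the ring morphism structure depends. *)
Definition reduce_mor (p : nat) (pp : prime p) : padic_int p -> 'F_p := @reduce p.

HB.instance Definition _ (p : nat) (pp : prime p) :=
  GRing.isZmodMorphism.Build (padic_int p) 'F_p (reduce_mor pp) (reduce_zmod pp).
HB.instance Definition _ (p : nat) (pp : prime p) :=
  GRing.isMonoidMorphism.Build (padic_int p) 'F_p (reduce_mor pp) (reduce_monoid pp).

Section PadicPrime.
Variables (p : nat) (pp : prime p).
Local Notation Zp := (padic_int p).
Local Notation red := (reduce_mor pp).

Let p1 := prime_expS_gt1 pp.

Lemma reduce_surj (a : 'F_p) : red (a : nat)%:R = a.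
Proof. by rewrite rmorph_nat natr_Zp. Qed.

Lemma residue_modp (x : Zp) k : (x k %% p)%N = x 0%N :> nat.
Proof.
elim: k => [|k IH].
  rewrite modn_small //; have := ltn_ord (x 0%N).
  by rewrite [X in (_ < X)%N -> _]Zp_cast // expn1.
rewrite -IH -(padic_intP x k) /= modn_dvdm // Zp_cast //.
by rewrite expnS dvdn_mulr.
Qed.

(** If [x] is nonzero modulo [p], each residue is prime to [p], hence invertible modulo
    [p^(k+1)]. *)
Lemma padic_unitP (x : Zp) : red x != 0 <-> exists y, x * y = 1.
Proof.
split=> [x0|[y xy]]; last first.
  apply/eqP => x0; have := congr1 red xy.
  by rewrite rmorphM rmorph1 /= x0 mul0r => /eqP; rewrite eq_sym oner_eq0.
have ux k : x k \is a GRing.unit.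
  rewrite -[x k]natr_Zp unitZpE // coprime_pexpl // prime_coprime //.
  apply: contra x0 => /eqP; rewrite residue_modp => x00.
  by rewrite /reduce_mor /reduce x00.
have inM k (a b : 'Z_(p ^ k.+2)) :
    inZp (a * b)%R = inZp a * inZp b :> 'Z_(p ^ k.+1).
  by apply: val_inj; rewrite /= (modn_dvdm _ (level_dvd p k)) modnMm.
(* Uniqueness of inverses makes the levelwise inverses compatible. *)
have cy : coherent (fun k => (x k)^-1).
  move=> k; apply: (mulrI (ux k)); rewrite divrr ?ux //.
  have := inM k (x k.+1) (x k.+1)^-1; rewrite divrr ?ux // (padic_intP x k) => <-.
  exact: val_inj.
exists (PadicInt (asboolT cy)); apply: padic_int_inj => k.
exact/divrr/ux.
Qed.

(** Both sides say that [det P(A)] is nonzero modulo [p], since reduction commutes with evaluation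
    and determinant. In particular the choice of the lift [P] is immaterial. *)
Lemma coker_reduce n (A : 'M[Zp]_n.+1) (P : {poly Zp}) (Q : {poly 'F_p}) :
  map_poly (@reduce p) P = Q ->
  (forall x : coker (horner_mx A P), x = 0) <->
  horner_mx (map_mx red A) Q \in unitmx.
Proof.
rewrite -[@reduce p]/red => <-.
rewrite coker_eq0P -padic_unitP -map_horner_mx unitmxE det_map_mx.
by rewrite unitfE.
Qed.

Lemma open_reduce (a : 'F_p) : open [set x : Zp | red x = a].
Proof.
exists (@proj nat (fun k => discrete_topology 'Z_(p ^ k.+1)) 0%N @^-1`
   [set z : discrete_topology 'Z_(p ^ 1) | (z : nat)%:R = a]) => //.
by apply: open_comp; [move=> ? _; exact: proj_continuous|exact: discrete_open].
Qed.

Definition residue_class n (M : 'M['F_p]_n) : set 'M[Zp]_n :=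
  [set A | map_mx red A = M].

Lemma open_residue_class n (M : 'M['F_p]_n) : open (residue_class M).
Proof.
rewrite openE => A AM; exists (fun i j => [set x | red x = M i j]).
  move=> i j; apply: open_nbhs_nbhs; split; first exact: open_reduce.
  by rewrite /= -AM mxE.
by move=> B HB; apply/matrixP => i j; rewrite mxE HB.
Qed.

Definition residue_in n (U : pred 'M['F_p]_n) : set 'M[Zp]_n :=
  [set A | U (map_mx red A)].

Section Haar.
Variables (R : realType) (n : nat) (mu : probability (padic_mx p n) R).
Hypothesis Hmu : is_haar mu.

Lemma measurable_residue_class (M : 'M['F_p]_n) :
  measurable (residue_class M : set (padic_mx p n)).
Proof. by apply: sub_sigma_algebra; exact: open_residue_class. Qed.

(** Translation by an entrywise lift of [M] carries the class of 0 onto that of [M]. *)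
Lemma mu_residue_class (M : 'M['F_p]_n) :
  mu (residue_class M) = mu (residue_class (0 : 'M['F_p]_n)).
Proof.
rewrite -(Hmu (map_mx (fun a : 'F_p => (a : nat)%:R) M)
  (measurable_residue_class 0)).
congr (mu _); apply/seteqP; split=> [A AM|_ [A A0 <-]]; last first.
  rewrite /residue_class /= map_mxD A0 addr0.
  by apply/matrixP => i j; rewrite !mxE; exact: reduce_surj.
set B := map_mx _ _; exists (A - B); last by rewrite addrC subrK.
rewrite /residue_class /= map_mxB AM; apply/eqP; rewrite subr_eq0; apply/eqP.
by apply/matrixP => i j; rewrite !mxE; exact/esym/reduce_surj.
Qed.

Lemma mu_residue_seq (s : seq 'M['F_p]_n) : uniq s ->
  measurable (residue_in [in s] : set (padic_mx p n)) /\
  mu (residue_in [in s]) =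
   ((size s)%:R * fine (mu (residue_class (0 : 'M['F_p]_n))))%:E.
Proof.
elim: s => [_|M s IH /= /andP[Ms /IH[ms Es]]].
  have -> : residue_in [in [::] : seq 'M['F_p]_n] = set0 by apply/seteqP; split.
  by rewrite mul0r measure0; split.
have -> : residue_in [in M :: s] =
    residue_class M `|` residue_in [in s].
  apply/seteqP; split=> A; rewrite /residue_in /= inE.
    by move=> /predU1P[|]; [left|right].
  by move=> -[/= ->|->]; rewrite ?eqxx ?orbT.
have mM := measurable_residue_class M.
split; first exact: measurableU.
rewrite measureU //; last first.
  by rewrite -subset0 => A [AM As]; move/negP: Ms; rewrite -AM.
have EM : mu (residue_class M) = (fine (mu (residue_class (0 : 'M['F_p]_n))))%:E.
  rewrite mu_residue_class fineK // fin_num_measure //.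
  exact: measurable_residue_class.
apply: etrans (congr2 (fun x y => (x + y)%E) EM Es) _.
by rewrite -EFinD mulrSr mulrDl mul1r addrC.
Qed.

(** The [p ^ (n * n)] residue classes have equal mass and total mass 1, which fixes the mass of
    each. *)
Lemma mu_reduce (S : {set 'M['F_p]_n}) :
  mu (residue_in [in S]) = (#|S|%:R / p%:R ^+ (n * n))%:E.
Proof.
have [_ ET] := mu_residue_seq (enum_uniq (predT : pred 'M['F_p]_n)).
have [_ ES] := mu_residue_seq (enum_uniq S).
have E (U : pred 'M['F_p]_n) : residue_in [in enum U] = residue_in U.
  by apply/seteqP; split=> A; rewrite /residue_in /= mem_enum.
rewrite E -cardE in ES; rewrite ES; congr (_ * _)%:E.
rewrite E -cardE card_mx card_Fp // natrX in ET.
have : mu [set: 'M[Zp]_n] = 1%E by exact: probability_setT.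
have -> : [set: 'M[Zp]_n] = residue_in predT.
  by apply/seteqP; split.
rewrite ET => -[H]; apply: (mulfI (x := p%:R ^+ (n * n))).
  by rewrite expf_neq0 // pnatr_eq0 -lt0n prime_gt0.
by rewrite H divff // expf_neq0 // pnatr_eq0 -lt0n prime_gt0.
Qed.

End Haar.
End PadicPrime.

Lemma coker_event_residue (p : nat) (pp : prime p) n r (d : 'I_r -> nat)
    (lift : {poly 'F_p} -> {poly padic_int p}) :
  (forall j Q, monic_irreducible p (d j) Q ->
     map_poly (@reduce p) (lift Q) = Q) ->
  [set A : 'M[padic_int p]_n.+1 |
     forall (j : 'I_r) (Q : {poly 'F_p}), monic_irreducible p (d j) Q ->
       forall x : coker (horner_mx A (lift Q)), x = 0] =
  residue_in pp [in [set B : 'M['F_p]_n.+1 |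
    good_mx (irrs_of 'F_p [seq d j | j <- enum 'I_r]) B]%SET].
Proof.
move=> Hlift; apply/seteqP; split=> A; rewrite /residue_in /= inE.
  move=> HA; apply/allP => Q /irrs_ofP[_ /mapP[j _ ->]].
  rewrite mem_irrs => /and3P[mQ /irreducibleP iQ /eqP sQ].
  have HQ : monic_irreducible p (d j) Q by [].
  exact: (coker_reduce pp _ (Hlift _ _ HQ)).1 (HA j Q HQ).
move=> /allP HA j Q HQ; have [mQ /irreducibleP iQ /eqP sQ] := HQ.
apply: (coker_reduce pp _ (Hlift _ _ HQ)).2; apply: HA.
apply/irrs_ofP; exists (d j); first by rewrite map_f // mem_enum.
by rewrite mem_irrs mQ iQ sQ.
Qed.

Theorem theorem1p3 (R : realType) (r : nat) (d : 'I_r -> nat)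
    (d_gt0 : forall j, (0 < d j)%N) (d_inj : injective d) :
  exists L : nat -> R,
    (forall (n : nat)
        (mu : forall p : nat, probability (padic_mx p n.+1) R)
        (lift : forall p : nat, {poly 'F_p} -> {poly padic_int p}),
      (forall p : nat, prime p -> is_haar (mu p)) ->
      (forall (p : nat) (j : 'I_r) (Q : {poly 'F_p}), prime p ->
         monic_irreducible p (d j) Q ->
         map_poly (@reduce p) (lift p Q) = Q) ->
      mu p [set A : 'M[padic_int p]_n.+1 |
              forall (j : 'I_r) (Q : {poly 'F_p}),
                monic_irreducible p (d j) Q ->
                forall x : coker (horner_mx A (lift p Q)), x = 0]
        @[p --> within [set p : nat | prime p] \oo] --> (L n.+1)%:E) /\
    L n @[n --> \oo] --> (\prod_(j < r) expR (- (d j)%:R^-1) : R).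
Proof.
pose D := [seq d j | j <- enum 'I_r].
have uD : uniq D by rewrite map_inj_uniq // enum_uniq.
have D1 : all (leq 1) D by apply/allP => _ /mapP[j _ ->].
(* Truncating the factors at [n] preserves coefficients of degree at most [n], so this is the
   partial sum for the full exponential. *)
exists (fun n => psum n (\prod_(e <- D) expp R e n)); split; last first.
  have -> : \prod_(j < r) expR (- (d j)%:R^-1) =
      \prod_(e <- D) expR (- e%:R^-1) :> R.
    by rewrite big_map big_enum.
  exact: cvg_psum_prod_expp.
move=> n mu lift haar Hlift.
pose a p : R := #|[set B : 'M['F_p]_n.+1 | good_mx (irrs_of 'F_p D) B]%SET|%:R
  / qF R p ^+ (n.+1 * n.+1).
(* The probability equals [a p] at every prime, which suffices along [near_primes]. *)
apply: (@cvg_trans _ ((a p)%:E @[p --> near_primes])).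
  apply: near_eq_cvg; exists 0%N => // p _ pp.
  rewrite (@coker_event_residue p pp n r d (lift p)); last by move=> j Q; exact: Hlift.
  by rewrite (mu_reduce _ (haar p pp)) /a /qF card_Fp.
apply: cvg_EFin; first by apply: nearW => p; rewrite fin_numE.
exact: cvg_good_mx.
Qed.
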